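(* Let $G$ be a bipartite graph whose two bipartition classes have unequal cardinalities. Let $V(G)=V_+\sqcup V_-$ be its bipartition, labelled so that $|V_+|>|V_-|$, let $\sigma$ be the corresponding sign vector, and write $Q=Q(G)$. Then $G$ has exactly three distinct $Q$-main eigenvalues, one of which is zero, if and only if there exist $a,b,t\in\mathbb{Z}_{>0}$ with $a^2>4b$ such that (i) $G$ is not semiregular; and (ii) $Q^2\mathbf{1}-aQ\mathbf{1}+b\mathbf{1}=t\sigma$. In this case the $Q$-main polynomial of $G$ is $x(x^2-ax+b)$. Moreover, any such triple $(a,b,t)$ necessarily satisfies $b\equiv t\pmod 2$ and $0<t<b$.
   Context: All graphs are finite, simple, connected, undirected, and have at least one edge. For a graph $G$, $A(G)$ is the adjacency matrix, $D(G)$ the diagonal matrix of vertex degrees, and $Q(G)=A(G)+D(G)$ is the signless Laplacian; $\mathbf{1}$ is the all-ones vector. An eigenvalue $\lambda$ of $Q(G)$ is $Q$-main if its eigenspace is not orthogonal to $\mathbf{1}$. If the distinct $Q$-main eigenvalues of $G$ are $\lambda_1,\ldots,\lambda_m$, the $Q$-main polynomial of $G$ is $\prod_{i=1}^{m}(x-\lambda_i)$. The sign vector of an ordered bipartition $V(G)=V_+\sqcup V_-$ is $\sigma\in\{1,-1\}^{V(G)}$ with $\sigma(v)=1$ for $v\in V_+$ and $\sigma(v)=-1$ for $v\in V_-$. A bipartite graph with bipartition $V_+\sqcup V_-$ is semiregular if its vertex degree is constant on each of the two bipartition classes (the two constants may be equal or different). *)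

(* Defs.v *)
From HB Require Import structures.
From mathcomp Require Import all_boot all_order all_algebra.

Set Implicit Arguments.
Unset Strict Implicit.
Unset Printing Implicit Defensive.

Import Order.TTheory GRing.Theory Num.Theory.
Local Open Scope ring_scope.

Definition simple_graph (T : finType) (e : rel T) : Prop :=
  symmetric e /\ irreflexive e.

Definition connected_graph (T : finType) (e : rel T) : Prop :=
  forall x y : T, connect e x y.

Definition has_edge (T : finType) (e : rel T) : Prop :=
  exists x y : T, e x y.

Definition degree (T : finType) (e : rel T) (x : T) : nat :=
  #|[set y | e x y]|.

Definition bipartition (T : finType) (e : rel T) (Vp Vm : {set T}) : Prop :=
  [/\ Vp :|: Vm = [set: T], [disjoint Vp & Vm],
      {in Vp &, forall x y, ~~ e x y} & {in Vm &, forall x y, ~~ e x y}].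

Definition semiregular (T : finType) (e : rel T) (Vp Vm : {set T}) : Prop :=
  {in Vp &, forall x y, degree e x = degree e y} /\
  {in Vm &, forall x y, degree e x = degree e y}.

Definition adjacency_mx (R : pzRingType) (T : finType) (e : rel T) :
    'M[R]_#|T| :=
  \matrix_(i, j) (e (enum_val i) (enum_val j))%:R.

Definition degree_mx (R : pzRingType) (T : finType) (e : rel T) :
    'M[R]_#|T| :=
  diag_mx (\row_i (degree e (enum_val i))%:R).

Definition signless_laplacian (R : pzRingType) (T : finType) (e : rel T) :
    'M[R]_#|T| :=
  adjacency_mx R e + degree_mx R e.

Definition ones (R : pzRingType) (T : finType) : 'cV[R]_#|T| := const_mx 1.

(* Takes the value -1 on the complement of Vp, that is, on Vm whenever
   (Vp, Vm) is a bipartition. *)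
Definition sign_vector (R : pzRingType) (T : finType) (Vp : {set T}) :
    'cV[R]_#|T| :=
  \col_i (if enum_val i \in Vp then 1 else -1).

(* MathComp eigenvectors are row vectors; as the signless Laplacian is
   symmetric, transposition identifies them with column eigenvectors. *)
Definition Qmain (R : fieldType) (T : finType) (e : rel T) (l : R) : Prop :=
  eigenvalue (signless_laplacian R e) l /\
  exists2 v : 'rV[R]_#|T|,
    (v <= eigenspace (signless_laplacian R e) l)%MS & v *m ones R T != 0.

Definition Qmain_spectrum (R : fieldType) (T : finType) (e : rel T)
    (s : seq R) : Prop :=
  uniq s /\ forall l : R, l \in s <-> Qmain e l.

Definition is_Qmain_poly (R : fieldType) (T : finType) (e : rel T)
    (p : {poly R}) : Prop :=
  exists2 s : seq R, Qmain_spectrum e s & p = \prod_(l <- s) ('X - l%:P).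

Definition Qmain_triple (R : fieldType) (T : finType) (e : rel T)
    (Vp Vm : {set T}) (a b t : nat) : Prop :=
  let Q := signless_laplacian R e in
  [/\ [/\ (0 < a)%N, (0 < b)%N & (0 < t)%N],
      (4 * b < a ^ 2)%N,
      ~ semiregular e Vp Vm &
      Q ^+ 2 *m ones R T - a%:R *: (Q *m ones R T) + b%:R *: ones R T
        = t%:R *: sign_vector R Vp].

(* Main.v *)
Require Import Defs.
From HB Require Import structures.
From mathcomp Require Import all_boot all_order all_algebra.
From mathcomp Require Import complex ring lra zify.

Set Implicit Arguments.
Unset Strict Implicit.
Unset Printing Implicit Defensive.

Import Order.TTheory GRing.Theory Num.Theory.
Local Open Scope ring_scope.

(** Write 1 for the all-ones vector and sigma for the sign vector of the
    bipartition.  The Q-main eigenvalues are the roots of the minimal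
    polynomial annihilating 1 under Q: a product of factors (Q - m) kills 1
    as soon as the m include every Q-main eigenvalue ([mulmx_roots_eq0], by
    the spectral theorem), and only then ([Qmain_root]).

    On a connected bipartite graph ker Q is the line spanned by sigma
    ([signless_laplacian_ker]), because x^T Q x is the sum of
    (x_u + x_v)^2 over the edges.  Hence, 1 is killed by Q (Q - l1) (Q - l2)
    if and only if (Q - l1) (Q - l2) 1 is a multiple t sigma of sigma, which is
    the quadratic relation with a = l1 + l2 and b = l1 l2.  Moreover, semiregularity
    says precisely that Q 1 lies in the span of 1 and sigma
    ([semiregularE]), that is, that Q (Q - c) kills 1 for some c; this
    separates three Q-main eigenvalues from at most two.

    From the spectrum to a triple, the point is that a, b and t are positive
    integers.  Reading the relation at two vertices of different degree in one class
    shows that a is rational; one vertex in each class then gives b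
    ([quadratic_rational]).  As (X - l1) (X - l2) divides the characteristic
    polynomial of an integer matrix, Gauss's lemma makes a and b integers
    ([eigenvalue_pair_int]), and then t is one too.  Pairing the relation with sigma,
    which is orthogonal to the image of Q, gives b (|V+| - |V-|) = t |V|
    ([quadratic_balance]): this yields t > 0 here, and t < b for any triple.

    From a triple to the spectrum, 0 is Q-main because
    sigma^T 1 = |V+| - |V-| is nonzero, and each root l1 of x^2 - a x + b is
    Q-main because v = Q (Q - l2) 1 is an eigenvector for l1 whose pairing
    with 1 cannot vanish unless v does, in which case the graph is
    semiregular ([Qmain_of_roots]). *)

(** * Products of shifts of a symmetric matrix *)

(** The product of the factors (A - m), for m in s, applied to x; phrased with
    a fold because horner_mx requires a dimension of the form n.+1. *)
Definition mulmx_roots (R : pzRingType) n (A : 'M[R]_n) (s : seq R)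
    (x : 'cV[R]_n) : 'cV[R]_n :=
  foldr (fun m y => A *m y - m *: y) x s.

Lemma map_mulmx_roots (R S : comNzRingType) (f : {rmorphism R -> S}) n
    (A : 'M[R]_n) (s : seq R) (x : 'cV[R]_n) :
  map_mx f (mulmx_roots A s x)
    = mulmx_roots (map_mx f A) (map f s) (map_mx f x).
Proof.
by elim: s => //= m s IHs; rewrite map_mxB map_mxM map_mxZ IHs.
Qed.

Lemma eigen_mulmx_roots (R : comNzRingType) n (A : 'M[R]_n) (s : seq R)
    (x : 'cV[R]_n) (l : R) (u : 'rV[R]_n) :
  u *m A = l *: u ->
  u *m mulmx_roots A s x = (\prod_(m <- s) (l - m)) *: (u *m x).
Proof.
move=> uA; elim: s => [|m s IHs] /=; first by rewrite big_nil scale1r.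
rewrite mulmxBr mulmxA uA -scalemxAl -scalemxAr -scalerBl IHs scalerA.
by rewrite big_cons.
Qed.

(** Over R[i] the symmetric matrix A is unitarily diagonalizable with real
    eigenvalues, so it is enough to test the vector against each row
    eigenvector u.  Either u x = 0, or the eigenspace of A over R for the same
    eigenvalue is not orthogonal to x either, since eigenspaces commute with
    field extension; the eigenvalue is then in s and its factor vanishes. *)
Lemma mulmx_roots_eq0 (R : rcfType) n (A : 'M[R]_n) (s : seq R)
    (x : 'cV[R]_n) :
  A^T = A -> (forall l, eigenspace A l *m x != 0 -> l \in s) ->
  mulmx_roots A s x = 0.
Proof.
move=> symA mainP; pose f := real_complex R; pose AC := map_mx f A.
have herA : AC \is hermsymmx.
  apply: realsym_hermsym.
    apply/is_hermitianmxP; rewrite expr0 scale1r map_mx_id //.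
    by rewrite map_trmx symA.
  by apply/mxOverP => i j; rewrite mxE; apply/Creal_ImP; rewrite -complexIm.
have /hermitian_normalmx/orthomx_spectralP := herA.
set P := spectralmx AC; set d := spectral_diag AC => AC_E.
have unitP : P \in unitmx := spectral_unit AC.
apply/eqP; rewrite -(map_mx_eq0 f); apply/eqP.
rewrite -[LHS](mulKmx unitP); set y := P *m _.
suff -> : y = 0 by rewrite mulmx0.
apply/row_matrixP => i; rewrite row0 row_mul map_mulmx_roots.
pose r := complex.Re (d 0 i).
have dE : d 0 i = f r.
  have /mxOverP/(_ 0 i)/RRe_real := hermitian_spectral_diag_real herA.
  by move=> {1}<-.
have PiA : row i P *m map_mx f A = f r *: row i P.
  rewrite -dE -row_mul -/AC AC_E !mulmxA mulmxV // mul1mx.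
  by rewrite row_mul row_diag_mx -scalemxAl -rowE.
rewrite (eigen_mulmx_roots _ _ PiA).
have [->|Pix] := eqVneq (row i P *m map_mx f x) 0; first by rewrite scaler0.
suff /(map_f f) rs : r \in s.
  by rewrite (big_rem (f r)) //= subrr mul0r scale0r.
apply: mainP; apply: contraNneq Pix => Ex0.
have /eigenspaceP := PiA; rewrite -map_eigenspace => /submxP[w ->].
by rewrite -mulmxA -map_mxM Ex0 map_mx0 mulmx0.
Qed.

Lemma mulmx_roots2 (R : comNzRingType) n (A : 'M[R]_n) (l1 l2 : R)
    (x : 'cV[R]_n) :
  mulmx_roots A [:: l1; l2] x
    = A ^+ 2 *m x - (l1 + l2) *: (A *m x) + (l1 * l2) *: x.
Proof.
rewrite /= -[A ^+ 2 *m x]mulmxA mulmxBr -scalemxAr.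
by move: (A *m (A *m x)) (A *m x) => y z; apply/colP => i; rewrite !mxE; ring.
Qed.

Lemma mulmx_trmx_eq0 (R : realDomainType) n (x : 'cV[R]_n) :
  x^T *m x = 0 -> x = 0.
Proof.
move=> /matrixP/(_ 0 0); rewrite !mxE => /eqP.
rewrite psumr_eq0 => [/allP xx0|j _]; last by rewrite mxE -expr2 sqr_ge0.
apply/colP => i; have := xx0 i; rewrite mem_index_enum !mxE => /(_ isT).
by rewrite mulf_eq0 orbb => /eqP.
Qed.

(** * Integrality of a quadratic factor of a characteristic polynomial *)

(** Gauss's lemma: the scalar multiple of p with integer coefficients provided by
    [dvdpP_rat_int] has a leading coefficient dividing 1, so the scaling factor is a sign. *)
Lemma monic_dvdp_int (p : {poly rat}) (q : {poly int}) :
  p \is monic -> q \is monic -> p %| map_poly intr q ->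
  exists p1 : {poly int}, p = map_poly intr p1.
Proof.
move=> mp mq /dvdpP_rat_int[p1 [c c0 pE] [r qE]].
have l1lr : lead_coef p1 * lead_coef r = 1.
  by rewrite -lead_coefM -qE; apply/eqP.
have l1l1 : lead_coef p1 * lead_coef p1 = 1.
  have /eqP := congr1 absz l1lr; rewrite abszM muln_eq1 => /andP[l1 _].
  by move: (lead_coef p1) l1 => [[|[|k]]|[|k]].
have cl1 : c * (lead_coef p1)%:~R = 1.
  move/eqP: mp; rewrite pE lead_coefZ lead_coef_map_inj //.
  exact: intr_inj.
have cE : c = (lead_coef p1)%:~R.
  have := congr1 ( *%R^~ (lead_coef p1)%:~R) cl1.
  by rewrite /= -mulrA -intrM l1l1 mulr1 mul1r.
by exists (lead_coef p1 *: p1); rewrite map_polyZ pE cE.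
Qed.

(** (X - l1) (X - l2) has rational coefficients and divides the characteristic
    polynomial of A over R, hence already over the rationals. *)
Lemma eigenvalue_pair_int (R : numFieldType) n (A : 'M[int]_n) (l1 l2 : R)
    (a b : rat) :
  eigenvalue (map_mx intr A) l1 -> eigenvalue (map_mx intr A) l2 ->
  l1 != l2 -> l1 + l2 = ratr a -> l1 * l2 = ratr b ->
  exists za zb : int, l1 + l2 = za%:~R /\ l1 * l2 = zb%:~R.
Proof.
rewrite !eigenvalue_root_char -!map_char_poly => rt1 rt2 neq12 aE bE.
pose p : {poly rat} := 'X^2 + (- a%:P * 'X + b%:P).
have sz : (size (- a%:P * 'X + b%:P)%R < size ('X^2 : {poly rat})%R)%N.
  rewrite -polyCN size_MXaddC size_polyXn; case: ifP => // _.
  by rewrite !ltnS size_polyC leq_b1.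
have mp : p \is monic by rewrite monicE lead_coefDl // lead_coefXn.
have pE : map_poly ratr p = ('X - l1%:P) * ('X - l2%:P).
  rewrite /p !rmorphD /= map_polyXn rmorphM rmorphN /= map_polyX !map_polyC.
  by rewrite /= -aE -bE polyCD polyCM; ring.
have : p %| map_poly intr (char_poly A).
  rewrite -(dvdp_map (ratr : {rmorphism rat -> R})) -map_poly_comp.
  rewrite (eq_map_poly (g := intr)) => [|z]; last by rewrite /= ratr_int.
  rewrite pE; have := @uniq_roots_dvdp _ _ [:: l1; l2].
  rewrite !big_cons big_nil mulr1; apply; first by rewrite /= rt1 rt2.
  by rewrite uniq_rootsE /= inE neq12.
case/(monic_dvdp_int mp (char_poly_monic A)) => p1 p1E.
exists (- p1`_1), p1`_0; rewrite aE bE.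
have coefp i : p`_i = (p1`_i)%:~R by rewrite p1E coef_map.
have := coefp 0%N; have := coefp 1%N.
rewrite /p -polyCN !coefE /= ?(mulr0, mulr1, add0r, addr0) => aE' bE'.
by rewrite -[a]opprK aE' bE' -mulrNz !ratr_int.
Qed.

(** * The signless Laplacian *)

Lemma map_signless_laplacian (R S : pzRingType) (f : {rmorphism R -> S})
    (T : finType) (e : rel T) :
  map_mx f (signless_laplacian R e) = signless_laplacian S e.
Proof. by apply/matrixP => i j; rewrite !mxE rmorphD !rmorphMn rmorph1. Qed.

Section SignlessLaplacian.

Variables (R : rcfType) (T : finType) (e : rel T).
Hypothesis e_sym : symmetric e.

Local Notation Q := (signless_laplacian R e).
Local Notation one := (ones R T).
Local Notation adj i j := (e (enum_val i) (enum_val j)).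

Lemma card_adj (i : 'I_#|T|) :
  #|[pred j : 'I_#|T| | adj i j]| = degree e (enum_val i).
Proof.
rewrite /degree -sum1dep_card [RHS](reindex _ (onW_bij _ (@enum_val_bij T))).
by rewrite sum1_card.
Qed.

Lemma signless_laplacianE (x : 'cV[R]_#|T|) i :
  (Q *m x) i 0 = \sum_(j | adj i j) (x i 0 + x j 0).
Proof.
rewrite mulmxDl mxE mul_diag_mx !mxE addrC big_split /=; congr (_ + _).
  by rewrite sumr_const card_adj mulr_natl.
rewrite [RHS]big_mkcond; apply: eq_bigr => j _; rewrite mxE.
by case: ifP; rewrite ?mul1r ?mul0r.
Qed.

Lemma tr_signless_laplacian : Q^T = Q.
Proof.
apply/matrixP => i j; rewrite !mxE e_sym; congr (_ + _).
by rewrite eq_sym; case: eqP => // ->.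
Qed.

(** Each edge is counted in both orientations, whence the factor 2. *)
Lemma signless_laplacian_form (x : 'cV[R]_#|T|) :
  2 * (x^T *m (Q *m x)) 0 0
    = \sum_i \sum_(j | adj i j) (x i 0 + x j 0) ^+ 2.
Proof.
have -> : (x^T *m (Q *m x)) 0 0 =
    \sum_i \sum_(j | adj i j) x i 0 * (x i 0 + x j 0).
  rewrite mxE; apply: eq_bigr => i _.
  by rewrite signless_laplacianE mxE mulr_sumr.
rewrite mulr_natl mulr2n [X in _ + X](exchange_big_dep predT) //=.
rewrite -big_split /=.
apply: eq_bigr => i _.
rewrite [X in _ + X](eq_bigl (fun j => adj i j)) => [|j]; last first.
  by rewrite e_sym.
by rewrite -big_split; apply: eq_bigr => j _ /=; ring.
Qed.

(** This form of Q-mainness transfers along field extensions and supplies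
    the hypothesis of [mulmx_roots_eq0]. *)
Lemma QmainE l : Qmain e l <-> eigenspace Q l *m one != 0.
Proof.
split=> [[_ [v /submxP[w ->]]]|/rowV0Pn[v]].
  by rewrite -mulmxA; apply: contraNneq => ->; rewrite mulmx0.
case/submxP => w -> w1; rewrite mulmxA in w1.
have sE : (w *m eigenspace Q l <= eigenspace Q l)%MS by apply: submxMl.
split; last by exists (w *m eigenspace Q l).
by apply: contraNneq w1 => ->; rewrite mulmx0 mul0mx.
Qed.

Lemma Qmain_col l (v : 'cV[R]_#|T|) :
  Q *m v = l *: v -> v^T *m one != 0 -> Qmain e l.
Proof.
move=> Qv v1; apply/QmainE; apply: contraNneq v1 => E0.
have /submxP[w ->] : (v^T <= eigenspace Q l)%MS.
  by apply/eigenspaceP; rewrite -[Q]tr_signless_laplacian -trmx_mul Qv linearZ.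
by rewrite -mulmxA E0 mulmx0.
Qed.

Lemma Qmain_root l s : Qmain e l -> mulmx_roots Q s one = 0 -> l \in s.
Proof.
case=> _ [v /eigenspaceP vQ v1] s0; have := eigen_mulmx_roots s one vQ.
rewrite s0 mulmx0 => /esym/eqP; rewrite scaler_eq0 (negbTE v1) orbF.
by rewrite prodf_seq_eq0 => /hasP[m ms]; rewrite /= subr_eq0 => /eqP->.
Qed.

Lemma Qmain_mulmx_roots s :
  (forall l, Qmain e l -> l \in s) -> mulmx_roots Q s one = 0.
Proof.
move=> sP; apply: mulmx_roots_eq0; first exact: tr_signless_laplacian.
by move=> l /QmainE/sP.
Qed.

(** Q is positive semidefinite by [signless_laplacian_form]. *)
Lemma Qmain_ge0 (l : R) : Qmain e l -> 0 <= l.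
Proof.
case=> _ [v /eigenspaceP vQ v1].
have v0 : v != 0 by apply: contraNneq v1 => ->; rewrite mul0mx.
have Qv : Q *m v^T = l *: v^T.
  by rewrite -[Q]tr_signless_laplacian -trmx_mul vQ linearZ.
have := signless_laplacian_form v^T; rewrite Qv -scalemxAr mxE => vv.
have : 0 <= 2 * (l * (v^T^T *m v^T) 0 0).
  by rewrite vv; do 2!apply: sumr_ge0 => ? _; apply: sqr_ge0.
rewrite pmulr_rge0 ?ltr0n // pmulr_lge0 // lt_neqAle; apply/andP; split.
  rewrite eq_sym; apply: contraNneq v0 => vv0; rewrite -(trmxK v).
  rewrite (@mulmx_trmx_eq0 _ _ v^T) ?trmx0 //.
  by apply/matrixP => i j; rewrite !ord1 vv0 mxE.
by rewrite mxE; apply: sumr_ge0 => j _; rewrite !mxE -expr2 sqr_ge0.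
Qed.

Lemma signless_laplacian_ones i :
  (Q *m one) i 0 = 2 * (degree e (enum_val i))%:R.
Proof.
rewrite signless_laplacianE; under eq_bigr do rewrite !mxE.
by rewrite sumr_const card_adj -[1 + 1]/(2%:R) mulr_natr.
Qed.

Lemma signless_laplacian_sqr_ones i :
  exists m : nat, (Q ^+ 2 *m one) i 0 = 2 * m%:R.
Proof.
exists (\sum_(j : 'I_#|T| | adj i j)
          (degree e (enum_val i) + degree e (enum_val j)))%N.
rewrite -mulmxA signless_laplacianE natr_sum mulr_sumr; apply: eq_bigr => j _.
by rewrite !signless_laplacian_ones natrD mulrDr.
Qed.

End SignlessLaplacian.

(** * Bipartite graphs *)

Section BipartiteGraph.

Variables (R : rcfType) (T : finType) (e : rel T) (Vp Vm : {set T}).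
Hypothesis e_simple : simple_graph e.
Hypothesis e_conn : connected_graph e.
Hypothesis e_edge : has_edge e.
Hypothesis e_bip : bipartition e Vp Vm.

Let e_sym : symmetric e := proj1 e_simple.

Local Notation Q := (signless_laplacian R e).
Local Notation one := (ones R T).
Local Notation sigma := (sign_vector R Vp).
Local Notation sgn u := (if u \in Vp then 1 else -1 : R).

Lemma mem_bipartition u : (u \in Vm) = (u \notin Vp).
Proof.
case: e_bip => VT VD _ _; have := in_setT u; rewrite -VT inE.
by have [uP|_ /=] := boolP (u \in Vp); rewrite // (disjointFr VD uP).
Qed.

Lemma sgn_edge u v : e u v -> sgn u = - sgn v.
Proof.
case: e_bip => _ _ VpP VmP euv.
have [uP|uP] := ifPn; have [vP|vP] := ifPn; rewrite ?opprK //.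
  by rewrite (negbTE (VpP _ _ uP vP)) in euv.
by move: (VmP u v); rewrite !mem_bipartition euv uP vP => /(_ isT isT).
Qed.

Lemma bipartition_nonempty : exists2 u, u \in Vp & exists v, v \in Vm.
Proof.
have [u [v euv]] := e_edge; case: e_bip => _ _ VpP VmP.
have [uP|uP] := boolP (u \in Vp);
  [exists u => //; exists v | exists v; last exists u].
- by rewrite mem_bipartition; apply: contraL euv => vP; apply: VpP.
- have := VmP u v; rewrite !mem_bipartition uP euv.
  by case: (v \in Vp) => // /(_ isT isT).
- by rewrite mem_bipartition.
Qed.

Lemma signless_laplacian_sign : Q *m sigma = 0.
Proof.
apply/colP => i; rewrite signless_laplacianE [RHS]mxE big1 // => j eij.
by rewrite !mxE (sgn_edge eij) addNr.
Qed.

(** If Q x = 0, the sum of squares x^T Q x vanishes, so x changes sign along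
    every edge; x times sigma is then constant along edges, and on the whole
    graph by connectedness. *)
Lemma signless_laplacian_ker (x : 'cV[R]_#|T|) :
  Q *m x = 0 -> exists c, x = c *: sigma.
Proof.
move=> Qx0; have [u0 _] := e_edge.
pose y u := x (enum_rank u) 0 * sgn u.
have y_edge u v : e u v -> y u = y v.
  move=> euv; have := signless_laplacian_form e_sym x.
  rewrite Qx0 mulmx0 mxE mulr0 => /esym/eqP.
  rewrite psumr_eq0 => [/allP/(_ (enum_rank u))|i _]; last first.
    by apply: sumr_ge0 => j _; apply: sqr_ge0.
  rewrite mem_index_enum => /(_ isT) /=.
  rewrite psumr_eq0 => [/allP/(_ (enum_rank v))|j _]; last exact: sqr_ge0.
  rewrite mem_index_enum !enum_rankK euv sqrf_eq0 addr_eq0 => /(_ isT)/eqP xu.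
  by rewrite /y xu (sgn_edge euv) mulrNN.
have y_const u : y u = y u0.
  have /connectP[p] := e_conn u0 u.
  elim: p u0 => [u1 _ -> //|v p IHp u1] /= /andP[/y_edge-> ep] up.
  exact: IHp.
exists (y u0); apply/colP => i.
rewrite !mxE -(y_const (enum_val i)) /y enum_valK.
by case: ifP => _; rewrite -mulrA ?mulrNN !mulr1.
Qed.

Lemma dot_ones_sign : one^T *m sigma = (#|Vp|%:R - #|Vm|%:R)%:M.
Proof.
apply/matrixP => i j; rewrite !ord1 !mxE eqxx mulr1n.
under eq_bigr do rewrite !mxE mul1r.
transitivity (\sum_u sgn u).
  by rewrite [RHS](reindex _ (onW_bij _ (@enum_val_bij T))).
rewrite (bigID (mem Vp)) /=; congr (_ + _).
  by rewrite (eq_bigr (fun=> 1)) => [|u ->]; rewrite ?sumr_const.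
rewrite (eq_bigr (fun=> -1)) => [|u /negbTE->] //.
rewrite sumr_const mulNrn; congr (- _%:R).
by apply: eq_card => u; rewrite mem_bipartition.
Qed.

(** Q 1 is twice the degree vector, and the vectors that are constant on each
    class form the span of 1 and sigma. *)
Lemma semiregularE :
  semiregular e Vp Vm <->
  exists c d : R, Q *m one = c *: one + d *: sigma.
Proof.
have [u uP [v vM]] := bipartition_nonempty.
have vP : v \notin Vp by rewrite -mem_bipartition.
split=> [[regP regM]|[c [d Q1]]].
  exists ((degree e u)%:R + (degree e v)%:R).
  exists ((degree e u)%:R - (degree e v)%:R).
  apply/colP => i; rewrite signless_laplacian_ones !mxE.
  case: ifPn => [iP|iP]; first by rewrite (regP _ _ iP uP); ring.
  by rewrite (regM _ _ _ vM) ?mem_bipartition //; ring.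
have deg w : 2 * (degree e w)%:R = c + d * sgn w.
  have := congr1 (fun z : 'cV[R]__ => z (enum_rank w) 0) Q1.
  by rewrite signless_laplacian_ones !mxE enum_rankK mulr1.
have degI w1 w2 : sgn w1 = sgn w2 -> degree e w1 = degree e w2.
  move=> sw; apply/eqP; rewrite -(eqr_nat R).
  rewrite -(inj_eq (mulfI (_ : 2 != 0 :> R))).
    by rewrite !deg sw.
  by rewrite pnatr_eq0.
split=> w1 w2; first by move=> w1P w2P; apply: degI; rewrite w1P w2P.
rewrite !mem_bipartition => /negbTE w1P /negbTE w2P.
by apply: degI; rewrite w1P w2P.
Qed.

(** Put v = Q (Q - l2) 1.  Then Q v - l1 v = Q (t sigma) = 0, and since Q is
    symmetric v^T v = v^T Q (Q - l2) 1 = l1 (l1 - l2) v^T 1.  If v^T 1 = 0 then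
    v = 0, so (Q - l2) 1 is in ker Q, a multiple of sigma, and the graph is
    semiregular. *)
Lemma Qmain_of_roots (l1 l2 t : R) :
  ~ semiregular e Vp Vm -> mulmx_roots Q [:: l1; l2] one = t *: sigma ->
  Qmain e l1.
Proof.
move=> nreg roots12; pose v := mulmx_roots Q [:: 0; l2] one.
have QR : Q *m mulmx_roots Q [:: l1; l2] one = 0.
  by rewrite roots12 -scalemxAr signless_laplacian_sign scaler0.
have Qv : Q *m v = l1 *: v.
  have /eqP := QR; rewrite /v /= scale0r subr0 mulmxBr -scalemxAr.
  by rewrite subr_eq0 => /eqP.
apply: (Qmain_col e_sym Qv); apply/eqP => v1; apply: nreg.
have v0 : v = 0.
  apply: mulmx_trmx_eq0; rewrite {2}/v /= scale0r subr0.
  rewrite mulmxA -[Q in v^T *m Q](tr_signless_laplacian R e_sym) -trmx_mul Qv.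
  rewrite linearZ /= mulmxBr -scalemxAl mulmxA.
  rewrite -[Q in v^T *m Q](tr_signless_laplacian R e_sym) -trmx_mul Qv.
  by rewrite linearZ /= -scalemxAr -!scalemxAl v1 !scaler0 subrr.
have [c cE] : exists c, Q *m one - l2 *: one = c *: sigma.
  by apply: signless_laplacian_ker; move: v0; rewrite /v /= scale0r subr0.
by apply/semiregularE; exists l2, c; rewrite -cE addrC subrK.
Qed.

Lemma Qmain_zero : #|Vp| != #|Vm| -> Qmain e (0 : R).
Proof.
move=> neqV; apply: (Qmain_col e_sym (v := sigma)).
  by rewrite signless_laplacian_sign scale0r.
rewrite -trmx_eq0 trmx_mul trmxK dot_ones_sign.
by rewrite fmorph_eq0 subr_eq0 eqr_nat.
Qed.

Lemma Qmain_spectrum_of_roots (l1 l2 t : R) :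
  #|Vp| != #|Vm| -> uniq [:: 0; l1; l2] ->
  ~ semiregular e Vp Vm -> mulmx_roots Q [:: l1; l2] one = t *: sigma ->
  Qmain_spectrum e [:: 0; l1; l2].
Proof.
move=> neqV uniq_s nreg roots12; split=> // l; split.
  rewrite !inE => /or3P[]/eqP->; first exact: Qmain_zero.
    exact: Qmain_of_roots roots12.
  apply: (Qmain_of_roots (l2 := l1) (t := t)) => //.
  by rewrite -roots12 !mulmx_roots2 [l1 + _]addrC [l1 * _]mulrC.
move/Qmain_root; apply.
rewrite -[LHS]/(Q *m mulmx_roots Q [:: l1; l2] one - 0 *: _) roots12.
by rewrite scale0r subr0 -scalemxAr signless_laplacian_sign scaler0.
Qed.

(** Pair the relation with sigma, which is orthogonal to the image of Q. *)
Lemma quadratic_balance (a b t : R) :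
  Q ^+ 2 *m one - a *: (Q *m one) + b *: one = t *: sigma ->
  b * (#|Vp|%:R - #|Vm|%:R) = t * #|T|%:R.
Proof.
move/(congr1 (mulmx sigma^T)); rewrite mulmxDr mulmxBr -!scalemxAr.
rewrite -[Q ^+ 2 *m one]mulmxA !mulmxA.
have -> : sigma^T *m Q = 0.
  rewrite -[Q](tr_signless_laplacian R e_sym) -trmx_mul.
  by rewrite signless_laplacian_sign trmx0.
rewrite !mul0mx scaler0 subrr add0r.
have -> : sigma^T *m one = (#|Vp|%:R - #|Vm|%:R)%:M.
  by rewrite -[LHS]trmxK trmx_mul trmxK dot_ones_sign tr_scalar_mx.
have -> : sigma^T *m sigma = #|T|%:R%:M.
  apply/matrixP => i j; rewrite !ord1 !mxE eqxx mulr1n.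
  rewrite (eq_bigr (fun=> 1)) ?sumr_const ?card_ord // => k _.
  by rewrite !mxE; case: ifP => _; rewrite ?mulrNN mulr1.
by move/matrixP/(_ 0 0); rewrite !mxE eqxx !mulr1n.
Qed.

(** Here 2 m is the entry of Q^2 1 at u.  That m is a natural number provides
    the rationality of a and b, and the parity of b - t. *)
Lemma quadratic_entry (a b t : R) :
  Q ^+ 2 *m one - a *: (Q *m one) + b *: one = t *: sigma ->
  forall u, exists m : nat,
    2 * m%:R - a * (2 * (degree e u)%:R) + b = t * sgn u.
Proof.
move=> eqQ u; have [m mE] := signless_laplacian_sqr_ones R e (enum_rank u).
exists m; have := congr1 (fun z : 'cV[R]__ => z (enum_rank u) 0) eqQ.
rewrite [LHS]mxE [X in X + _]mxE mE [X in _ + X + _]mxE [X in - X]mxE.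
by rewrite signless_laplacian_ones !mxE enum_rankK mulr1.
Qed.

End BipartiteGraph.

(** * The coefficients of the quadratic relation *)

Lemma irregular_pair (T : finType) (e : rel T) (Vp Vm : {set T}) :
  ~ semiregular e Vp Vm ->
  exists u v, degree e u <> degree e v /\
    (u \in Vp /\ v \in Vp \/ u \in Vm /\ v \in Vm).
Proof.
move=> nreg; have [/existsP[u /existsP[v /andP[uv duv]]]|no] := boolP
    [exists u, exists v, ((u \in Vp) && (v \in Vp) || (u \in Vm) && (v \in Vm))
      && (degree e u != degree e v)].
  by exists u, v; split; [apply/eqP | case/orP: uv => /andP; [left | right]].
case: nreg; split=> u v uP vP; apply/eqP; move: no; apply: contraNT => duv;
  by apply/existsP; exists u; apply/existsP; exists v; rewrite uP vP ?orbT.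
Qed.

Section Coefficients.

Variables (R : rcfType) (T : finType) (e : rel T) (Vp Vm : {set T}).
Hypothesis e_simple : simple_graph e.
Hypothesis e_conn : connected_graph e.
Hypothesis e_edge : has_edge e.
Hypothesis e_bip : bipartition e Vp Vm.

Local Notation Q := (signless_laplacian R e).
Local Notation one := (ones R T).
Local Notation sigma := (sign_vector R Vp).

(** Subtracting the relation at two vertices of the same class cancels b and
    t, and determines a if their degrees differ; adding it at two vertices of
    opposite classes cancels t and determines b. *)
Lemma quadratic_rational (a b t : R) :
  ~ semiregular e Vp Vm ->
  Q ^+ 2 *m one - a *: (Q *m one) + b *: one = t *: sigma ->
  exists qa qb : rat, a = ratr qa /\ b = ratr qb.
Proof.
move=> nreg eqQ; have ent := quadratic_entry eqQ.
have Vm_Vp w : w \in Vm -> (w \in Vp) = false.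
  by rewrite (mem_bipartition e_bip) => /negbTE.
have [u [v [duv uvP]]] := irregular_pair nreg.
have [mu muE] := ent u; have [mv mvE] := ent v.
have {muE mvE} aE : a * ((degree e u)%:R - (degree e v)%:R) = mu%:R - mv%:R.
  by case: uvP muE mvE => -[uP vP]; rewrite ?uP ?vP ?Vm_Vp //; lra.
have d0 : (degree e u)%:R - (degree e v)%:R != 0 :> R.
  by rewrite subr_eq0 eqr_nat; apply/eqP.
have {aE} aE : a = ratr ((mu%:R - mv%:R) / ((degree e u)%:R - (degree e v)%:R)).
  by rewrite fmorph_div !rmorphB !rmorph_nat /= -aE mulfK.
have [x xP [y yM]] := bipartition_nonempty e_edge e_bip.
have [mx] := ent x; have [my] := ent y; rewrite xP Vm_Vp // => myE mxE.
set q := _ / _ in aE; exists q.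
exists (q * ((degree e x)%:R + (degree e y)%:R) - (mx%:R + my%:R)).
split=> //; rewrite rmorphB rmorphM !rmorphD !rmorph_nat /= -aE; lra.
Qed.

(** The integrality and positivity of the coefficients: a and b come from
    [quadratic_rational] and [eigenvalue_pair_int], t from any single entry
    of the relation, and its sign from [quadratic_balance]. *)
Lemma Qmain_triple_of_roots (l1 l2 t : R) :
  (#|Vm| < #|Vp|)%N -> Qmain e l1 -> Qmain e l2 -> 0 < l1 -> 0 < l2 ->
  l1 != l2 -> ~ semiregular e Vp Vm ->
  mulmx_roots Q [:: l1; l2] one = t *: sigma ->
  exists a b t : nat, Qmain_triple R e Vp Vm a b t.
Proof.
move=> ltV [ev1 _] [ev2 _] l1_gt0 l2_gt0 neq12 nreg.
rewrite mulmx_roots2 => eqQ.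
have [qa [qb [qaE qbE]]] := quadratic_rational nreg eqQ.
have [za [zb [zaE zbE]]] : exists za zb : int,
    l1 + l2 = za%:~R /\ l1 * l2 = zb%:~R.
  apply: (eigenvalue_pair_int (A := signless_laplacian _ e)) qaE qbE => //;
  by rewrite map_signless_laplacian.
have a_gt0 : 0 < l1 + l2 by apply: addr_gt0.
have b_gt0 : 0 < l1 * l2 by apply: mulr_gt0.
move: (a_gt0) (b_gt0); rewrite zaE zbE !ltr0z.
case: za zaE => // a aE; case: zb zbE => // b bE a0 b0.
have bal := quadratic_balance e_simple e_bip eqQ.
have [x xP _] := bipartition_nonempty e_edge e_bip.
have T_gt0 : 0 < #|T|%:R :> R by rewrite ltr0n; apply/card_gt0P; exists x.
have t_gt0 : 0 < t.
  rewrite -(pmulr_lgt0 _ T_gt0) -bal mulr_gt0 // subr_gt0 ltr_nat //.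
have [m] := quadratic_entry eqQ x; rewrite xP mulr1 => tE.
pose zt : int := 2 * m%:Z - a%:Z * (2 * (degree e x)%:Z) + b%:Z.
have ztE : t = zt%:~R.
  by rewrite -tE aE bE /zt !(rmorphD, rmorphN, rmorphM) /=.
move: t_gt0; rewrite ztE ltr0z; case: (zt) ztE => // t' t'E t'0.
exists a, b, t'; split=> //; last by rewrite -[a%:R]aE -[b%:R]bE -[t'%:R]t'E.
rewrite -(ltr_nat R) natrM natrX -[a%:R]aE -[b%:R]bE -subr_gt0.
have -> : (l1 + l2) ^+ 2 - 4 * (l1 * l2) = (l1 - l2) ^+ 2 by ring.
by rewrite exprn_even_gt0 // subr_eq0.
Qed.

(** The nonzero Q-main eigenvalues l1 and l2 are positive.  A semiregular
    graph has its Q-main eigenvalues among 0 and a single c, which would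
    force l1 = l2. *)
Lemma Qmain_triple_of_spectrum (s : seq R) :
  (#|Vm| < #|Vp|)%N -> Qmain_spectrum e s -> size s = 3%N -> 0 \in s ->
  exists a b t : nat, Qmain_triple R e Vp Vm a b t.
Proof.
move=> ltV [uniq_s s_main] size_s s0.
have e_sym : symmetric e := proj1 e_simple.
have perm_s := perm_to_rem s0.
have : size (rem 0 s) = 2%N by rewrite size_rem // size_s.
case: (rem 0 s) perm_s => [|l1 [|l2 []]] // perm_s _.
move: uniq_s; rewrite (perm_uniq perm_s) /= !inE negb_or.
case/andP => /andP[n1 n2] /andP[n12 _].
have mainE l : l \in [:: 0; l1; l2] <-> Qmain e l by rewrite -(perm_mem perm_s).
have main1 : Qmain e l1 by apply/mainE; rewrite !inE eqxx orbT.
have main2 : Qmain e l2 by apply/mainE; rewrite !inE eqxx !orbT.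
have l1_gt0 : 0 < l1 by rewrite lt_neqAle n1 (Qmain_ge0 e_sym).
have l2_gt0 : 0 < l2 by rewrite lt_neqAle n2 (Qmain_ge0 e_sym).
have root3 : mulmx_roots Q [:: 0; l1; l2] one = 0.
  by apply: Qmain_mulmx_roots => // l /mainE.
have [t tE] : exists t, mulmx_roots Q [:: l1; l2] one = t *: sigma.
  apply: (signless_laplacian_ker e_simple e_conn e_edge e_bip).
  by move: root3; rewrite /= scale0r subr0.
apply: Qmain_triple_of_roots (tE) => //.
case/(semiregularE R e_edge e_bip) => c [d Q1].
have root2 : mulmx_roots Q [:: 0; c] one = 0.
  rewrite /= scale0r subr0 Q1 [c *: _ + _]addrC addrK -scalemxAr.
  by rewrite (signless_laplacian_sign R e_bip) scaler0.
have := Qmain_root main1 root2; have := Qmain_root main2 root2.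
rewrite !inE ![_ == 0]eq_sym (negbTE n1) (negbTE n2) /= => /eqP l2c /eqP l1c.
by rewrite l1c l2c eqxx in n12.
Qed.

Lemma Qmain_triple_spectrum (a b t : nat) :
  (#|Vm| < #|Vp|)%N -> Qmain_triple R e Vp Vm a b t ->
  exists l1 l2 : R, [/\ l1 + l2 = a%:R, l1 * l2 = b%:R &
    Qmain_spectrum e [:: 0; l1; l2]].
Proof.
move=> ltV [[a0 b0 t0] disc nreg eqQ].
pose D : R := a%:R ^+ 2 - 4 * b%:R.
have D_gt0 : 0 < D by rewrite /D -natrX -natrM subr_gt0 ltr_nat.
have sD_gt0 : 0 < Num.sqrt D by rewrite sqrtr_gt0.
have sD2 : Num.sqrt D ^+ 2 = D by rewrite sqr_sqrtr // ltW.
pose l1 := (a%:R + Num.sqrt D) / 2; pose l2 := (a%:R - Num.sqrt D) / 2.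
have sumE : l1 + l2 = a%:R by rewrite /l1 /l2; field.
have prodE : l1 * l2 = b%:R.
  have -> : l1 * l2 = (a%:R ^+ 2 - Num.sqrt D ^+ 2) / 4.
    by rewrite /l1 /l2; field.
  by rewrite sD2 /D; field.
have b_neq0 : b%:R != 0 :> R by rewrite pnatr_eq0 -lt0n.
exists l1, l2; split=> //.
apply: (@Qmain_spectrum_of_roots R T e Vp Vm e_simple e_conn e_edge e_bip
  l1 l2 t%:R) => //.
- by rewrite neq_ltn ltV orbT.
- move: b_neq0; rewrite -prodE mulf_eq0 negb_or => /andP[n1 n2].
  rewrite /= !inE negb_or ![0 == _]eq_sym n1 n2 /= andbT -subr_eq0.
  have -> : l1 - l2 = Num.sqrt D by rewrite /l1 /l2; field.
  by rewrite gt_eqF.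
- by rewrite mulmx_roots2 sumE prodE.
Qed.

(** The parity is read off one entry of the relation; the bound t < b follows
    from b (|V+| - |V-|) = t (|V+| + |V-|) with V- nonempty. *)
Lemma Qmain_triple_arith (a b t : nat) :
  (#|Vm| < #|Vp|)%N -> Qmain_triple R e Vp Vm a b t ->
  b = t %[mod 2] /\ (0 < t < b)%N.
Proof.
move=> ltV [[a0 b0 t0] _ _ eqQ].
have [x xP [y yM]] := bipartition_nonempty e_edge e_bip.
split.
  have [m] := quadratic_entry eqQ x; rewrite xP mulr1 => /eqP.
  rewrite -[2]/(2%:R) -!natrM addrAC subr_eq -!natrD eqr_nat => /eqP.
  by move: (degree e x) => d; lia.
rewrite t0 /=; have := quadratic_balance e_simple e_bip eqQ.
have Vm_gt0 : (0 < #|Vm|)%N by apply/card_gt0P; exists y.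
have cardT : #|T| = (#|Vp| + #|Vm|)%N.
  case: e_bip => VT VD _ _; rewrite -cardsT -VT cardsU.
  by rewrite (disjoint_setI0 VD) cards0 subn0.
rewrite -natrB ?(ltnW ltV) // -!natrM => /eqP; rewrite eqr_nat cardT => /eqP.
by nia.
Qed.

End Coefficients.

Theorem theorem3p2 (R : rcfType) (T : finType) (e : rel T) (Vp Vm : {set T})
    (e_simple : simple_graph e) (e_conn : connected_graph e)
    (e_edge : has_edge e) (e_bip : bipartition e Vp Vm)
    (ltV : (#|Vm| < #|Vp|)%N) :
  ((exists s : seq R, [/\ Qmain_spectrum e s, size s = 3%N & 0 \in s])
    <-> (exists a b t : nat, Qmain_triple R e Vp Vm a b t))
  /\
  (forall a b t : nat, Qmain_triple R e Vp Vm a b t ->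
     [/\ is_Qmain_poly e ('X * ('X^2 - a%:R *: 'X + b%:R%:P) : {poly R}),
         b = t %[mod 2] & (0 < t < b)%N]).
Proof.
have spectrum a b t := @Qmain_triple_spectrum R T e Vp Vm e_simple e_conn
  e_edge e_bip a b t ltV.
split; [split=> [[s [sP s3 s0]]|[a [b [t]]]] | move=> a b t abt].
- exact: Qmain_triple_of_spectrum sP s3 s0.
- case/spectrum => l1 [l2 [_ _ sP]].
  by exists [:: 0; l1; l2]; split; rewrite // inE eqxx.
have [bt tb] := Qmain_triple_arith e_simple e_edge e_bip ltV abt.
split=> //; have [l1 [l2 [<- <- sP]]] := spectrum _ _ _ abt.
exists [:: 0; l1; l2] => //.
by rewrite !big_cons big_nil mulr1 subr0 -mul_polyC polyCD polyCM; ring.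
Qed.
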